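(* Let $(U,D,A,L)$ with $U\in\mathrm{SO}(p)$, $D\in\mathrm{Diag}^+(p)$, $A\in\mathfrak{so}(p)$, $L\in\mathrm{Diag}(p)$ be the parameters of a scaling–rotation curve $\chi(t)=\chi(t;U,D,A,L)$ in $\mathrm{Sym}^+(p)$. Let $I\subset\mathbb{R}$ be a positive-length interval containing $0$. Then a geodesic $\gamma:I\to \mathrm{SO}(p)\times\mathrm{Diag}^+(p)$ satisfies $\chi(t)=c(\gamma(t))$ for all $t\in I$ if and only if $$\gamma(t)=\gamma(t;\,URP_\pi',\,D_\pi,\,B,\,L_\pi)$$ for some $\pi\in S_p$, $R\in G_{D,L}$, and $B\in\mathfrak{so}(p)$ satisfying both (i) $\tilde B-\tilde A\in\mathfrak{g}_{D,L}$, where $\tilde B=U'BU$ and $\tilde A=U'AU$, and (ii) $(\mathrm{ad}_{\tilde B})^j(\tilde A)\in\mathfrak{g}_{D,L}$ for all $j\ge1$.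
   Context: A prime denotes transpose. $\mathrm{Sym}^+(p)$ is the set of real symmetric positive-definite $p\times p$ matrices; $\mathrm{SO}(p)$ the set of rotation matrices; $\mathfrak{so}(p)$ the set of real antisymmetric $p\times p$ matrices; $\mathrm{Diag}(p)$ the real diagonal matrices; $\mathrm{Diag}^+(p)$ the diagonal matrices with positive diagonal entries (in no particular order). Scaling–rotation curve: $\chi(t;U,D,A,L)=\exp(At)\,U\,D\exp(Lt)\,U'\exp(A't)$. $\mathrm{SO}(p)\times\mathrm{Diag}^+(p)$ carries the Riemannian metric which, for tangent vectors $(A_1U,L_1D),(A_2U,L_2D)$ at $(U,D)$ ($A_i\in\mathfrak{so}(p)$, $L_i\in\mathrm{Diag}(p)$), is $\frac{k}{2}\mathrm{trace}(A_1A_2')+\mathrm{trace}(L_1L_2)$, with $k>0$ fixed. Its geodesics are the curves $\gamma(t;U,D,A,L)=(\exp(At)U,\ \exp(Lt)D)$, with $(U,D)\in\mathrm{SO}(p)\times\mathrm{Diag}^+(p)$, $A\in\mathfrak{so}(p)$, $L\in\mathrm{Diag}(p)$. The eigen-composition map is $c(U,D)=UDU'$. $S_p$ is the group of permutations of $\{1,\dots,p\}$. For $\pi\in S_p$, $P_\pi^0$ is the matrix whose entries are all $0$ except that in column $i$ the entry in row $\pi(i)$ equals $1$; $P_\pi=P_\pi^0$ if $\det P_\pi^0=1$, and $P_\pi=\mathrm{diag}(-1,1,\dots,1)P_\pi^0$ otherwise. For $D\in\mathrm{Diag}(p)$, $D_\pi=P_\pi DP_\pi'$ (and likewise $L_\pi=P_\pi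 LP_\pi'$). $G_D=\{R\in\mathrm{SO}(p):RDR'=D\}$ for $D\in\mathrm{Diag}(p)$. For $D=\mathrm{diag}(d_1,\dots,d_p)$ and $L=\mathrm{diag}(l_1,\dots,l_p)$, let $\mathcal{J}_{D,L}$ be the partition of $\{1,\dots,p\}$ in which $i,j$ lie in the same block iff $d_i=d_j$ and $l_i=l_j$. Then $G_{D,L}=G_D\cap G_L$ and its Lie algebra is $\mathfrak{g}_{D,L}=\{A\in\mathfrak{so}(p):A_{ij}=0$ whenever $i,j$ are in different blocks of $\mathcal{J}_{D,L}\}$. For $B\in\mathfrak{so}(p)$, $\mathrm{ad}_B:\mathfrak{so}(p)\to\mathfrak{so}(p)$ is $\mathrm{ad}_B(C)=BC-CB$. *)

(* Defs.v *)
From HB Require Import structures.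
From mathcomp Require Import all_boot all_order all_algebra all_fingroup.
From mathcomp Require Import all_classical all_reals all_analysis.
Import Order.TTheory GRing.Theory Num.Theory numFieldNormedType.Exports.

Set Implicit Arguments.
Unset Strict Implicit.
Unset Printing Implicit Defensive.

Local Open Scope classical_set_scope.
Local Open Scope ring_scope.

Section Definitions.
Context {R : realType} {p : nat}.
Implicit Types (U V D A L B C M : 'M[R]_p) (t : R).

Definition SO : set 'M[R]_p := [set U | U *m U^T = 1%:M /\ \det U = 1].

Definition so : set 'M[R]_p := [set A | A^T = - A].

Definition Diag : set 'M[R]_p := [set D | is_diag_mx D].

Definition Diag_pos : set 'M[R]_p := [set D | Diag D /\ forall i, 0 < D i i].

(* The limit is taken in the normed space of matrices; the series always
   converges, so the value is never the default point of [lim]. *)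
Definition expm M : 'M[R]_p :=
  limn (series (fun k : nat => (k`!%:R)^-1 *: (M ^+ k))).

Definition sr_curve U D A L t : 'M[R]_p :=
  expm (t *: A) *m U *m D *m expm (t *: L) *m U^T *m expm (t *: A^T).

Definition eig_comp (x : 'M[R]_p * 'M[R]_p) : 'M[R]_p :=
  x.1 *m x.2 *m x.1^T.

Definition geod U D A L t : 'M[R]_p * 'M[R]_p :=
  (expm (t *: A) *m U, expm (t *: L) *m D).

(* Geodesics on [I] of SO(p) x Diag^+(p) for the metric
     (k/2) tr(A1 A2') + tr(L1 L2)   at   (A1 U, L1 D), (A2 U, L2 D).
   This is a product of bi-invariant metrics on Lie groups, so for every k > 0
   its geodesics are exactly the curves [geod U D A L].  Curves are total
   functions on R; only their values on [I] matter. *)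
Definition geodesic_on (I : set R) (gamma : R -> 'M[R]_p * 'M[R]_p) : Prop :=
  exists U D A L, [/\ SO U, Diag_pos D, so A, Diag L
    & forall t, I t -> gamma t = geod U D A L t].

(* The opposite indexing convention to mathcomp's [perm_mx s], which is
   [\matrix_(i, j) (s i == j)%:R]. *)
Definition Pmx0 (s : 'S_p) : 'M[R]_p := \matrix_(i, j) (i == s j)%:R.

(* diag(-1, 1, ..., 1) *)
Definition flip1 : 'M[R]_p :=
  \matrix_(i, j) (if i == j then (if val i == 0%N then -1 else 1) else 0).

Definition Pmx (s : 'S_p) : 'M[R]_p :=
  if \det (Pmx0 s) == 1 then Pmx0 s else flip1 *m Pmx0 s.

Definition perm_conj (s : 'S_p) D : 'M[R]_p := Pmx s *m D *m (Pmx s)^T.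

Definition G_ D : set 'M[R]_p := [set Q | SO Q /\ Q *m D *m Q^T = D].

Definition G2_ D L : set 'M[R]_p := G_ D `&` G_ L.

(* [i] and [j] lie in the same block of the partition J_{D,L}. *)
Definition same_block D L : rel 'I_p :=
  fun i j => (D i i == D j j) && (L i i == L j j).

Definition g2_ D L : set 'M[R]_p :=
  [set A | so A /\ forall i j, ~~ same_block D L i j -> A i j = 0].

Definition ad B C : 'M[R]_p := B *m C - C *m B.

Definition conj_by U A : 'M[R]_p := U^T *m A *m U.

End Definitions.

Arguments SO {R} p.
Arguments so {R} p.
Arguments Diag {R} p.
Arguments Diag_pos {R} p.
Arguments expm {R p}.

(* Main.v *)
(** Factor the frame of the geodesic as [U *m Q *m (Pmx s)^T]: comparing
spectra at enough times of [I] (finitely many permutations, and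
[t |-> ln d + t l] is affine) gives one permutation [s] valid for all times.
With [~] denoting conjugation by [U] and [Phi t = expm (t *: L) *m D], the
curves agree iff [F t = expm (- t *: ~B) *m expm (t *: ~A)] satisfies
[F Phi F^T = Q Phi Q^T].  Value and derivative at 0 give [Q] in [G_{D,L}], so
[F t] commutes with [Phi t]; away from the isolated times where two distinct
blocks of [Phi t] meet, this says that [F t] is block diagonal.  Hence so are
its derivatives at 0, [X_{k+1} = X_k ~A - ~B X_k = X_k X_1 - ad_{~B} X_k], and
Leibniz' rule for [ad] turns this into conditions (i) and (ii).  Conversely,
(i) and (ii) make all [X_k] block diagonal, and [F] is the exponential series
in the [X_k]. *)

Require Import Defs.
From HB Require Import structures.
From mathcomp Require Import all_boot all_order all_algebra all_fingroup.
From mathcomp Require Import all_classical all_reals all_analysis lra.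
Import Order.TTheory GRing.Theory Num.Theory numFieldNormedType.Exports.

Set Implicit Arguments.
Unset Strict Implicit.
Unset Printing Implicit Defensive.

Local Open Scope classical_set_scope.
Local Open Scope ring_scope.

(** * Entrywise calculus of matrix-valued curves *)

Section MatrixCurves.
Context {R : realType}.

(** Entrywise and at every time, so that scalar calculus applies to matrices of any shape, including
    the row vectors [mxvec X]. *)
Definition mxderiv {m n : nat} (F G : R -> 'M[R]_(m, n)) : Prop :=
  forall i j (t : R), is_derive t (1 : R) (fun s => F s i j) (G t i j).

Lemma mxderiv_eq m n (F G H : R -> 'M[R]_(m, n)) :
  mxderiv F G -> (forall t, G t = H t) -> mxderiv F H.
Proof. by move=> FG GH i j t; rewrite -GH. Qed.

Lemma mxderiv_cst m n (C : 'M[R]_(m, n)) : mxderiv (fun=> C) (fun=> 0).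
Proof. by move=> i j t; rewrite mxE; exact: is_derive_cst. Qed.

Lemma mxderivD m n (F F' G G' : R -> 'M[R]_(m, n)) :
  mxderiv F F' -> mxderiv G G' ->
  mxderiv (fun t => F t + G t) (fun t => F' t + G' t).
Proof.
move=> dF dG i j t; rewrite !mxE.
have -> : (fun s => (F s + G s) i j) = (fun s => F s i j) + (fun s => G s i j).
  by apply/funext => s; rewrite !mxE.
exact: is_deriveD.
Qed.

Lemma mxderivB m n (F F' G G' : R -> 'M[R]_(m, n)) :
  mxderiv F F' -> mxderiv G G' ->
  mxderiv (fun t => F t - G t) (fun t => F' t - G' t).
Proof.
move=> dF dG i j t; rewrite !mxE.
have -> : (fun s => (F s - G s) i j) = (fun s => F s i j) - (fun s => G s i j).
  by apply/funext => s; rewrite !mxE.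
exact: is_deriveB.
Qed.

Lemma mxderivM m n q (F F' : R -> 'M[R]_(m, n)) (G G' : R -> 'M[R]_(n, q)) :
  mxderiv F F' -> mxderiv G G' ->
  mxderiv (fun t => F t *m G t) (fun t => F' t *m G t + F t *m G' t).
Proof.
move=> dF dG i j t; rewrite !mxE -big_split /=.
have -> : (fun s => (F s *m G s) i j) =
    \sum_(k < n) ((fun s => F s i k) * (fun s => G s k j)).
  by apply/funext => s; rewrite fct_sumE mxE.
apply: is_derive_sum => k.
have /(_ (dF i k t) (dG k j t)) := @is_deriveM _ _ (fun s => F s i k)
  (fun s => G s k j) t 1 (F' t i k) (G' t k j).
by rewrite /GRing.scale /= addrC [G t k j * _]mulrC.
Qed.

Lemma mxderivMl m n q (C : 'M[R]_(m, n)) (F F' : R -> 'M[R]_(n, q)) :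
  mxderiv F F' -> mxderiv (fun t => C *m F t) (fun t => C *m F' t).
Proof.
move=> dF; apply: mxderiv_eq (mxderivM (mxderiv_cst C) dF) _ => t.
by rewrite mul0mx add0r.
Qed.

Lemma mxderivMr m n q (C : 'M[R]_(n, q)) (F F' : R -> 'M[R]_(m, n)) :
  mxderiv F F' -> mxderiv (fun t => F t *m C) (fun t => F' t *m C).
Proof.
move=> dF; apply: mxderiv_eq (mxderivM dF (mxderiv_cst C)) _ => t.
by rewrite mulmx0 addr0.
Qed.

Lemma mxderiv_tr m n (F F' : R -> 'M[R]_(m, n)) :
  mxderiv F F' -> mxderiv (fun t => (F t)^T) (fun t => (F' t)^T).
Proof.
move=> dF i j t; rewrite mxE.
by under eq_fun do rewrite mxE; exact: dF.
Qed.

Lemma mxderiv_vec m n (F F' : R -> 'M[R]_(m, n)) :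
  mxderiv F F' -> mxderiv (fun t => mxvec (F t)) (fun t => mxvec (F' t)).
Proof.
move=> dF i k t; rewrite (ord1 i); case/mxvec_indexP: k => j l.
by rewrite mxvecE; under eq_fun do rewrite mxvecE; exact: dF.
Qed.

Lemma mxderiv_unique m n (F G H : R -> 'M[R]_(m, n)) t :
  mxderiv F G -> mxderiv F H -> G t = H t.
Proof.
move=> FG FH; apply/matrixP => i j.
by rewrite -(@derive_val _ _ _ _ _ _ _ (FG i j t))
  (@derive_val _ _ _ _ _ _ _ (FH i j t)).
Qed.

Lemma mxderiv0_cst m n (F : R -> 'M[R]_(m, n)) s t :
  mxderiv F (fun=> 0) -> F s = F t.
Proof.
move=> dF; apply/matrixP => i j.
apply: (@is_derive_0_is_cst _ (fun u => F u i j)) => u.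
by have := dF i j u; rewrite mxE.
Qed.

Lemma mxderiv_continuous m n (F F' : R -> 'M[R]_(m, n)) i j :
  mxderiv F F' -> continuous (fun t => F t i j).
Proof.
move=> dF t; apply: differentiable_continuous; apply/derivable1_diffP.
exact: (@ex_derive _ _ _ _ _ _ _ (dF i j t)).
Qed.

Lemma continuous_eq0_itvcc (f : R -> R) a b :
  a < b -> continuous f -> (forall t, t \in `]a, b[ -> f t = 0) ->
  (forall t, t \in `[a, b] -> f t = 0).
Proof.
move=> ab cf f0 t; rewrite in_itv /= => /andP[at_ tb].
apply/eqP; apply: contraT; rewrite -normr_gt0 => ft.
have /cvgrPdist_lt /(_ _ ft) := cf t.
rewrite near_simpl => /nbhs_ballP [e /= e0 he].
have [s [sab st]] : exists s, (s \in `]a, b[) /\ `|t - s| < e.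
  (* Moving [t] by the fraction [u] of the way to the midpoint lands strictly inside, at distance at
     most [u * (b - a) / 2 < e]. *)
  set u := Num.min 1 (e / (b - a)).
  have ba : 0 < b - a by rewrite subr_gt0.
  have u0 : 0 < u by rewrite lt_min ltr01 divr_gt0.
  have u1 : u <= 1 by rewrite ge_min lexx.
  have ue : u * (b - a) <= e by rewrite -ler_pdivlMr// ge_min lexx orbT.
  exists (t + u * ((a + b) / 2 - t)); split.
    by rewrite in_itv /=; apply/andP; split; nra.
  by rewrite ltr_norml; apply/andP; split; nra.
have := he s; rewrite /ball /= => /(_ st).
by rewrite (f0 s sab) subr0 ltxx.
Qed.

(** Inside the interval [f] is locally constant, and continuity of [g] adds the endpoints. They
    matter because 0 may be an end of the given time interval. *)
Lemma derive_eq0_itvcc (f g : R -> R) a b :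
  a < b -> (forall t : R, is_derive t (1 : R) f (g t)) -> continuous g ->
  (forall t, t \in `]a, b[ -> f t = 0) -> (forall t, t \in `[a, b] -> g t = 0).
Proof.
move=> ab df cg f0; apply: continuous_eq0_itvcc => // t tab.
have d0 : is_derive t (1 : R) f 0.
  apply: (@near_eq_is_derive _ _ _ (cst 0)) => //.
  near=> s; rewrite f0//; near: s.
  exact: near_in_itvoo.
by rewrite -(@derive_val _ _ _ _ _ _ _ (df t)) (@derive_val _ _ _ _ _ _ _ d0).
Unshelve. all: by end_near. Qed.

Lemma cvg_mx m n (S : nat -> 'M[R]_(m, n)) (X : 'M[R]_(m, n)) :
  (forall i j, (fun k => S k i j) @ \oo --> X i j) -> S @ \oo --> X.
Proof.
move=> SX; apply/cvg_ballP => e e0; near=> k; split => // i j.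
have /(_ (i, j)) // : forall ij, ball (X ij.1 ij.2) e (S k ij.1 ij.2).
near: k; apply: filter_forall => ij.
by have /cvg_ballP/(_ _ e0) := SX ij.1 ij.2.
Unshelve. all: by end_near. Qed.

End MatrixCurves.

(** * The matrix exponential as a power series *)

Section MatrixExponential.
Context {R : realType} {p : nat}.
Implicit Types (M : 'M[R]_p) (t : R).

(* Taylor coefficients of an entry of [N *m expm (t *: M)]. *)
Definition expm_coef {q : nat} (N : 'M[R]_(q, p)) M i j : R^nat :=
  fun k => (N *m M ^+ k) i j / k`!%:R.

(** Submultiplicativity of the entry-sum norm, by induction on [k]. It lets a multiple of the real
    exponential series dominate the Taylor series. *)
Lemma norm_mulmx_exp_le q (N : 'M[R]_(q, p)) M i j k :
  `|(N *m M ^+ k) i j|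
  <= (\sum_a \sum_b `|N a b|) * (\sum_a \sum_b `|M a b|) ^+ k.
Proof.
have ge_entry m n (X : 'M[R]_(m, n)) a b : `|X a b| <= \sum_c \sum_d `|X c d|.
  rewrite (bigD1 a)//= (bigD1 b)//= -addrA lerDl addr_ge0// ?sumr_ge0// => c _.
  by rewrite sumr_ge0.
elim: k i j => [|k IHk] i j; first by rewrite expr0 mulmx1 mulr1 ge_entry.
rewrite exprSr mulmxA mxE exprSr mulrA.
apply: le_trans (ler_norm_sum _ _ _) _.
apply: (@le_trans _ _ (\sum_c (\sum_a \sum_b `|N a b|) *
    (\sum_a \sum_b `|M a b|) ^+ k * `|M c j|)).
  by apply: ler_sum => c _; rewrite normrM ler_wpM2r.
rewrite -mulr_sumr ler_wpM2l ?(le_trans _ (IHk i j))//.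
apply: ler_sum => c _; rewrite (bigD1 j)//= lerDl sumr_ge0//.
Qed.

Lemma cvg_expm_coef q (N : 'M[R]_(q, p)) M i j t :
  cvgn (pseries (expm_coef N M i j) t).
Proof.
pose C := \sum_a \sum_b `|N a b|; pose K := \sum_a \sum_b `|M a b|.
have C0 : 0 <= C by apply: sumr_ge0 => a _; apply: sumr_ge0.
have K0 : 0 <= K by apply: sumr_ge0 => a _; apply: sumr_ge0.
apply: normed_cvg.
apply: (@series_le_cvg _ _ (C *: exp_coeff (K * `|t|))) => [k|k|k|].
- exact: normr_ge0.
- by rewrite mulr_ge0// exp_coeff_ge0// mulr_ge0.
- rewrite -[leRHS]/(C * ((K * `|t|) ^+ k / k`!%:R)) /= /expm_coef.
  rewrite !normrM normfV normr_nat normrX exprMn -!mulrA [_^-1 * _]mulrC !mulrA.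
  by rewrite !ler_wpM2r ?exprn_ge0 ?invr_ge0// norm_mulmx_exp_le.
- exact/is_cvg_seriesZ/is_cvg_series_exp_coeff.
Qed.

(** Termwise differentiation only replaces [N] by [N *m M]; the left factor [N] is carried so that
    the family of coefficients is closed under it. *)
Lemma pseries_diffs_expm_coef q (N : 'M[R]_(q, p)) M i j :
  pseries_diffs (expm_coef N M i j) = expm_coef (N *m M) M i j.
Proof.
apply/funext => k; rewrite /pseries_diffs /expm_coef exprS mulmxA.
by rewrite mulrCA factS natrM invfM mulVKf// pnatr_eq0.
Qed.

Lemma expr_scalemx M t k : (t *: M) ^+ k = t ^+ k *: M ^+ k.
Proof.
elim: k => [|k IHk]; first by rewrite !expr0 scale1r.
by rewrite !exprS IHk -[LHS]/(_ *m _) -scalemxAl -scalemxAr scalerA.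
Qed.

(** Left multiplication by [N] passes to the limit because each entry is a finite sum; questions
    about [expm] become questions about real power series. *)
Lemma mulmx_expmE q (N : 'M[R]_(q, p)) M i j t :
  (N *m expm (t *: M)) i j = limn (pseries (expm_coef N M i j) t).
Proof.
pose S := series (fun k => k`!%:R^-1 *: (t *: M) ^+ k).
have SE r (X : 'M[R]_(r, p)) a b :
    (fun n => (X *m S n) a b) = pseries (expm_coef X M a b) t.
  apply/funext => n; rewrite /S /pseries /series /= mulmx_sumr summxE.
  apply: eq_bigr => k _; rewrite expr_scalemx -!scalemxAr [LHS]mxE.
  rewrite [X in _ * X]mxE.
  by rewrite /expm_coef mulrC [t ^+ k * _]mulrC mulrAC.
have S1 a b : (fun n => S n a b) = pseries (expm_coef 1%:M M a b) t.
  by rewrite -SE; apply/funext => n; rewrite mul1mx.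
have Scvg : S @ \oo --> \matrix_(a, b) limn (pseries (expm_coef 1%:M M a b) t).
  apply: cvg_mx => a b; rewrite mxE S1; exact: cvg_expm_coef.
have -> : expm (t *: M) =
    \matrix_(a, b) limn (pseries (expm_coef 1%:M M a b) t).
  by rewrite /expm (cvg_lim _ Scvg)//; exact: norm_hausdorff.
apply/esym/cvg_lim; first exact: Rhausdorff.
rewrite -SE; under eq_fun do rewrite mxE; rewrite mxE.
apply: cvg_big => [|a _]; first exact: add_continuous.
by apply: cvgMl_tmp; rewrite mxE S1; exact: cvg_expm_coef.
Qed.

Lemma mxderiv_expm q (N : 'M[R]_(q, p)) M :
  mxderiv (fun t => N *m expm (t *: M)) (fun t => N *m M *m expm (t *: M)).
Proof.
move=> i j t; under eq_fun do rewrite mulmx_expmE; rewrite mulmx_expmE.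
rewrite -pseries_diffs_expm_coef.
(* Any point beyond [|t|] would do: the series and its first two formal derivatives converge
   everywhere. *)
apply: (@pseries_snd_diffs _ _ (`|t| + 1)).
- exact: cvg_expm_coef.
- by rewrite pseries_diffs_expm_coef; exact: cvg_expm_coef.
- by rewrite !pseries_diffs_expm_coef; exact: cvg_expm_coef.
- by rewrite [ltRHS]ger0_norm ?addr_ge0// ltrDl.
Qed.

Lemma mxderiv_expm1 M :
  mxderiv (fun t => expm (t *: M)) (fun t => M *m expm (t *: M)).
Proof.
have := mxderiv_expm 1%:M M; rewrite mul1mx.
by under eq_fun do rewrite mul1mx.
Qed.

Lemma trmx_exp M k : (M ^+ k)^T = M^T ^+ k.
Proof.
elim: k => [|k IHk]; first by rewrite !expr0 trmx1.
by rewrite exprS exprSr trmx_mul IHk.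
Qed.

Lemma expm_tr M t : (expm (t *: M))^T = expm (t *: M^T).
Proof.
apply/matrixP => i j; rewrite mxE -[expm (t *: M)]mul1mx.
rewrite -[expm (_ *: M^T)]mul1mx !mulmx_expmE.
suff -> : expm_coef 1%:M M j i = expm_coef 1%:M M^T i j by [].
by apply/funext => k; rewrite /expm_coef !mul1mx -trmx_exp mxE.
Qed.

Lemma expm0 M : expm (0 *: M) = 1%:M.
Proof.
apply/matrixP => i j; rewrite -[expm _]mul1mx mulmx_expmE.
apply: cvg_lim; first exact: Rhausdorff.
apply: cvg_near_cst; near=> n; rewrite /pseries /series /=.
(* The empty partial sum is 0; the partial sums equal the entry of the identity from [n = 1] on. *)
have [m ->] : exists m, n = m.+1.
  by exists n.-1; rewrite prednK //; near: n; exists 1%N.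
rewrite big_nat_recl//= big1 => [|k _]; last by rewrite expr0n mulr0.
by rewrite /expm_coef expr0 mul1mx !mulr1 divr1 addr0.
Unshelve. all: by end_near. Qed.

(** Transposing the derivative of [expm (t *: M^T)] gives the derivative with [M] on the right, and
    derivatives are unique. *)
Lemma expm_comm M t : M *m expm (t *: M) = expm (t *: M) *m M.
Proof.
have dr : mxderiv (fun t => expm (t *: M)) (fun t => expm (t *: M) *m M).
  have := mxderiv_tr (mxderiv_expm1 M^T).
  under eq_fun do rewrite expm_tr trmxK.
  by under [X in mxderiv _ X]eq_fun do rewrite trmx_mul trmxK expm_tr trmxK.
exact: mxderiv_unique (mxderiv_expm1 M) dr.
Qed.

Lemma mxderiv_expmr M :
  mxderiv (fun t => expm (t *: M)) (fun t => expm (t *: M) *m M).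
Proof. by apply: mxderiv_eq (mxderiv_expm1 M) _ => t; rewrite expm_comm. Qed.

Lemma expmMN M t : expm (t *: M) *m expm (t *: - M) = 1%:M.
Proof.
have d0 : mxderiv (fun s => expm (s *: M) *m expm (s *: - M)) (fun=> 0).
  apply: mxderiv_eq (mxderivM (mxderiv_expm1 M) (mxderiv_expm1 (- M))) _ => s.
  by rewrite expm_comm -mulmxA mulNmx mulmxN subrr.
by have := mxderiv0_cst t 0 d0; rewrite !expm0 mul1mx.
Qed.

(** Uniqueness for the linear equation [Y' = Y M], by the integrating factor [expm (t *: - M)].
    Exponentials are identified below by checking that a curve solves such an equation. *)
Lemma mxderiv_expm_unique q (Y : R -> 'M[R]_(q, p)) M :
  mxderiv Y (fun t => Y t *m M) -> forall t, Y t = Y 0 *m expm (t *: M).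
Proof.
move=> dY t.
have d0 : mxderiv (fun s => Y s *m expm (s *: - M)) (fun=> 0).
  apply: mxderiv_eq (mxderivM dY (mxderiv_expm1 (- M))) _ => s.
  by rewrite mulNmx mulmxN mulmxA subrr.
have := mxderiv0_cst t 0 d0; rewrite expm0 mulmx1 => <-.
by rewrite -mulmxA -{2}[M]opprK expmMN mulmx1.
Qed.

End MatrixExponential.

(** * Exponential identities and the derivatives at 0 of a product of exponentials *)

Section Exponentials.
Context {R : realType} {p : nat}.
Implicit Types (U P M L A B X : 'M[R]_p) (t : R).

Lemma expm_conj P M t : P *m P^T = 1%:M ->
  P *m expm (t *: M) *m P^T = expm (t *: (P *m M *m P^T)).
Proof.
move=> PPt; have PtP := mulmx1C PPt.
have dY : mxderiv (fun s => P *m expm (s *: M) *m P^T)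
    (fun s => P *m expm (s *: M) *m P^T *m (P *m M *m P^T)).
  apply: mxderiv_eq (mxderivMr P^T (mxderivMl P (mxderiv_expmr M))) _ => s.
  by rewrite !mulmxA -[_ *m P^T *m P]mulmxA PtP mulmx1.
by rewrite (mxderiv_expm_unique dY t) expm0 mulmx1 PPt mul1mx.
Qed.

Lemma expm_diag L t : is_diag_mx L ->
  expm (t *: L) = diag_mx (\row_i expR (t * L i i)).
Proof.
move=> /is_diag_mxP Ld; apply/esym.
have dY : mxderiv (fun s => diag_mx (\row_i expR (s * L i i)))
    (fun s => diag_mx (\row_i expR (s * L i i)) *m L).
  move=> i j s; rewrite mul_diag_mx !mxE.
  under eq_fun do rewrite !mxE.
  have [<-|ij] := eqVneq i j; last first.
    rewrite (Ld i j)// mulr0; under eq_fun do rewrite mulr0n.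
    exact: is_derive_cst.
  under eq_fun do rewrite mulr1n.
  have := @is_derive1_comp R expR (fun u => u * L i i) s _ (L i i)
    (is_derive_expR _).
  apply.
  have := @is_deriveM R R (fun u => u) (fun=> L i i) s 1 1 0
    (is_derive_id _ _) (is_derive_cst _ _ _).
  by rewrite scaler0 add0r /GRing.scale /= mulr1.
rewrite (mxderiv_expm_unique dY t) (_ : diag_mx _ = 1%:M) ?mul1mx//.
by apply/matrixP => i j; rewrite !mxE mul0r expR0.
Qed.

Lemma expm_conj_by U A t : U *m U^T = 1%:M ->
  expm (t *: A) *m U = U *m expm (t *: conj_by U A).
Proof.
move=> UUt; have UtU := mulmx1C UUt.
have := @expm_conj U^T A t; rewrite trmxK => /(_ UtU) <-.
by rewrite !mulmxA UUt mul1mx.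
Qed.

(* [twist A B k] is the [k]-th derivative at 0 of
   [expm (t *: - B) *m expm (t *: A)]. *)
Fixpoint twist A B k : 'M[R]_p :=
  if k is k'.+1 then twist A B k' *m A - B *m twist A B k' else 1%:M.

(** Explains the recursion of [twist]: differentiation turns the middle factor [twist A B k] into
    [twist A B k.+1]. *)
Lemma mxderiv_twist A B X :
  mxderiv (fun t => expm (t *: - B) *m X *m expm (t *: A))
    (fun t => expm (t *: - B) *m (X *m A - B *m X) *m expm (t *: A)).
Proof.
apply: mxderiv_eq
  (mxderivM (mxderivMr X (mxderiv_expmr (- B))) (mxderiv_expm1 A)) _ => t.
rewrite mulmxBr mulmxBl mulmxN !mulNmx !mulmxA addrC; congr (_ - _).
Qed.

(** The map [X |-> X *m A - B *m X] acts on vectorised matrices as a matrix [T]. The vectorised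
    product solves [y' = y T], so it is [mxvec 1%:M *m expm (t *: T)], whose Taylor coefficients are
    the [twist A B k] up to factorials. *)
Lemma expm_twist_eq0 A B i j t : (forall k, twist A B k i j = 0) ->
  (expm (t *: - B) *m expm (t *: A)) i j = 0.
Proof.
move=> X0; pose T := lin_mulmxr A - lin_mulmx B.
have mulT X : mxvec X *m T = mxvec (X *m A - B *m X).
  by rewrite mulmxBr !mul_vec_lin linearB.
have dY : mxderiv (fun s => mxvec (expm (s *: - B) *m expm (s *: A)))
    (fun s => mxvec (expm (s *: - B) *m expm (s *: A)) *m T).
  under [X in mxderiv _ X]eq_fun do rewrite mulT.
  apply: mxderiv_vec.
  apply: mxderiv_eq
    (mxderivM (mxderiv_expm1 (- B)) (mxderiv_expmr A)) _ => s.
  by rewrite addrC !mulNmx !mulmxA.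
have mulTX k : mxvec 1%:M *m T ^+ k = mxvec (twist A B k).
  elim: k => [|k IHk]; first by rewrite mulmx1.
  by rewrite exprSr mulmxA IHk mulT.
rewrite -mxvecE (mxderiv_expm_unique dY t) !expm0 mulmx1 mulmx_expmE.
have -> : expm_coef (mxvec 1%:M) T 0 (mxvec_index i j) = fun=> 0.
  by apply/funext => k; rewrite /expm_coef mulTX mxvecE X0 mul0r.
apply: cvg_lim; first exact: Rhausdorff.
apply: cvg_near_cst; near=> n.
by rewrite /pseries /series /= big1// => k _; rewrite mul0r.
Unshelve. all: by end_near. Qed.

(** All derivatives of the entry vanish on the open interval, and by continuity at 0, which may be
    an endpoint. *)
Lemma twist_eq0 A B i j (a b : R) : a < b -> 0 \in `[a, b] ->
  (forall t, t \in `]a, b[ -> (expm (t *: - B) *m expm (t *: A)) i j = 0) ->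
  forall k, twist A B k i j = 0.
Proof.
move=> ab ab0 F0 k.
have dF l := @mxderiv_twist A B (twist A B l).
have {}F0 l t : t \in `]a, b[ ->
    (expm (t *: - B) *m twist A B l *m expm (t *: A)) i j = 0.
  elim: l t => [t tab|l IHl t tab]; first by rewrite mulmx1 F0.
  apply: (@derive_eq0_itvcc _ _ _ a b ab (dF l i j) _ IHl).
    exact: mxderiv_continuous (dF l.+1).
  exact: subset_itv_oo_cc.
have := continuous_eq0_itvcc ab
  (mxderiv_continuous (i := i) (j := j) (dF k)) (F0 k) ab0.
by rewrite !expm0 mul1mx mulmx1.
Qed.

End Exponentials.

(** * Block-diagonal matrices and iterated brackets *)

Section BlockAlgebra.
Context {R : realType} {p : nat} (e : rel 'I_p).
Hypotheses (e_refl : reflexive e) (e_trans : transitive e).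
Implicit Types (A B X Y : 'M[R]_p).

(** With [e] reflexive and transitive these matrices form an algebra with unit; [e] will be
    [same_block D L]. *)
Definition blockmx X := forall i j, ~~ e i j -> X i j = 0.

Lemma blockmx1 : blockmx 1%:M.
Proof. by move=> i j; rewrite mxE; case: eqP => // ->; rewrite e_refl. Qed.

Lemma blockmxD X Y : blockmx X -> blockmx Y -> blockmx (X + Y).
Proof. by move=> bX bY i j ij; rewrite mxE bX// bY// addr0. Qed.

Lemma blockmxN X : blockmx X -> blockmx (- X).
Proof. by move=> bX i j ij; rewrite mxE bX// oppr0. Qed.

Lemma blockmxM X Y : blockmx X -> blockmx Y -> blockmx (X *m Y).
Proof.
move=> bX bY i j ij; rewrite mxE big1// => l _.
have [il|il] := boolP (e i l); last by rewrite bX// mul0r.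
by rewrite (bY l j) ?mulr0//; apply: contra ij; exact: e_trans.
Qed.

Lemma ad_iterD B X Y n :
  iter n (ad B) (X + Y) = iter n (ad B) X + iter n (ad B) Y.
Proof.
by elim: n => //= n ->; rewrite /ad mulmxDr mulmxDl opprD addrACA.
Qed.

Lemma ad_iterN B X n : iter n (ad B) (- X) = - iter n (ad B) X.
Proof. by elim: n => //= n ->; rewrite /ad mulmxN mulNmx opprD. Qed.

Lemma ad_iterB B X Y n :
  iter n (ad B) (X - Y) = iter n (ad B) X - iter n (ad B) Y.
Proof. by rewrite ad_iterD ad_iterN. Qed.

Lemma adM B X Y : ad B (X *m Y) = ad B X *m Y + X *m ad B Y.
Proof. by rewrite /ad mulmxBl mulmxBr !mulmxA addrA subrK. Qed.

(** [ad B] is a derivation, so peeling off one application leaves two products to which the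
    hypotheses, shifted by one, still apply. *)
Lemma blockmx_ad_iterM B X Y n :
  (forall k, (k <= n)%N -> blockmx (iter k (ad B) X)) ->
  (forall k, (k <= n)%N -> blockmx (iter k (ad B) Y)) ->
  blockmx (iter n (ad B) (X *m Y)).
Proof.
elim: n X Y => [|n IHn] X Y bX bY.
  by apply: blockmxM; [exact: (bX 0%N)|exact: (bY 0%N)].
rewrite iterSr adM ad_iterD; apply: blockmxD; apply: IHn => k kn.
- by rewrite -iterSr; exact: bX.
- by apply: bY; exact: leqW.
- by apply: bX; exact: leqW.
- by rewrite -iterSr; exact: bY.
Qed.

(** [X A - B X = X (A - B) - (B X - X B)]: the recursion now involves only [A - B] and [ad B], the
    objects of conditions (i) and (ii). *)
Lemma twistS A B k :
  twist A B k.+1 = twist A B k *m twist A B 1 - ad B (twist A B k).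
Proof.
by rewrite /= mul1mx mulmx1 mulmxBr /ad opprB addrA subrK.
Qed.

(** [ad B] kills [B]. *)
Lemma ad_iterBl A B n : iter n.+1 (ad B) (B - A) = - iter n.+1 (ad B) A.
Proof.
rewrite !iterSr -ad_iterN; congr (iter n _ _).
by rewrite /ad mulmxBr mulmxBl !opprB addrC addrA subrK.
Qed.

(** Both directions control the double family [iter j (ad B) (twist A B k)]: the first by induction
    on [k] for all [j], the second by induction on [j] for all [k]. *)
Lemma blockmx_ad_twist A B :
  (blockmx (B - A) /\ forall j, (1 <= j)%N -> blockmx (iter j (ad B) A)) <->
  (forall k, blockmx (twist A B k)).
Proof.
have X1E : twist A B 1 = - (B - A) by rewrite /= mul1mx mulmx1 opprB.
split=> [[bBA bad] k|bX].
  suff bk : forall j, blockmx (iter j (ad B) (twist A B k)) by exact: (bk 0%N).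
  elim: k => [|k IHk] j.
    elim: j => [|j _]; first exact: blockmx1.
    rewrite iterSr /= {2}/ad mulmx1 mul1mx subrr.
    (* Zero is written as [1%:M - 1%:M] so that additivity shows that its iterated brackets
       vanish. *)
    rewrite -[X in iter _ _ X](subrr 1%:M) ad_iterB subrr.
    by move=> a b _; rewrite mxE.
  rewrite twistS ad_iterB -iterSr; apply/blockmxD; last exact/blockmxN/IHk.
  apply: blockmx_ad_iterM => l _; first exact: IHk.
  rewrite X1E ad_iterN; apply: blockmxN.
  by case: l => [//|l]; rewrite ad_iterBl; apply/blockmxN/bad.
have bad j : forall k, blockmx (iter j (ad B) (twist A B k)).
  elim/ltn_ind: j => -[|j] IHj k; first exact: bX.
  (* [twistS] is solved for the bracket: one bracket fewer, at the price of passing from [k] to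
     [k.+1]. *)
  rewrite iterSr (_ : ad B _ = twist A B k *m twist A B 1 - twist A B k.+1).
    rewrite ad_iterB; apply/blockmxD/blockmxN/IHj => //.
    by apply: blockmx_ad_iterM => l lj; exact: IHj.
  by rewrite (twistS A B k) opprB addrC subrK.
split=> [|[//|j] _]; first by have := blockmxN (bX 1%N); rewrite X1E opprK.
by rewrite -[iter _ _ _]opprK -ad_iterBl -ad_iterN -X1E; exact: bad.
Qed.

End BlockAlgebra.

(** * Diagonal matrices, their spectra and commutants *)

Section Diagonal.
Context {R : realType} {p : nat}.
Implicit Types (U P Q M L D A B X Y : 'M[R]_p) (s : 'S_p) (t : R).

(** Logarithms turn both sides into affine functions of time, and affine functions agreeing at two
    times coincide. *)
Lemma expR_affine_inj (d d' l l' s t : R) : 0 < d -> 0 < d' -> s != t ->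
  expR (s * l) * d = expR (s * l') * d' ->
  expR (t * l) * d = expR (t * l') * d' -> d = d' /\ l = l'.
Proof.
move=> d0 d'0 st.
have lnE (u m x : R) : 0 < x -> ln (expR (u * m) * x) = u * m + ln x.
  by move=> x0; rewrite lnM ?posrE ?expR_gt0// expRK.
move=> /(congr1 (@ln R)) + /(congr1 (@ln R)); rewrite !lnE// => Es Et.
have ll : l = l'.
  apply/eqP; rewrite -subr_eq0; have : (s - t) * (l - l') == 0.
    by apply/eqP; lra.
  by rewrite mulf_eq0 (subr_eq0 s) (negbTE st).
by split=> //; apply: ln_inj => //; move: Es; rewrite ll => /addrI.
Qed.

Lemma mulmx_diagl D X i j : is_diag_mx D -> (D *m X) i j = D i i * X i j.
Proof.
move=> /is_diag_mxP Dd; rewrite mxE (bigD1 i)//= big1 ?addr0// => k ki.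
by rewrite (Dd i k) ?mul0r// eq_sym.
Qed.

Lemma mulmx_diagr D X i j : is_diag_mx D -> (X *m D) i j = X i j * D j j.
Proof.
move=> /is_diag_mxP Dd; rewrite mxE (bigD1 j)//= big1 ?addr0// => k kj.
by rewrite (Dd k j) ?mulr0.
Qed.

Lemma diag_mx_ext D L : is_diag_mx D -> is_diag_mx L ->
  (forall i, D i i = L i i) -> D = L.
Proof.
move=> /is_diag_mxP Dd /is_diag_mxP Ld DL; apply/matrixP => i j.
have [->//|ij] := eqVneq i j.
by rewrite (Dd i j)// (Ld i j).
Qed.

Lemma is_diag_mulmx D L : is_diag_mx D -> is_diag_mx L -> is_diag_mx (D *m L).
Proof.
move=> dD dL; apply/is_diag_mxP => i j ij.
by rewrite mulmx_diagl// (is_diag_mxP dL i j ij) mulr0.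
Qed.

Lemma expm_is_diag L t : is_diag_mx L -> is_diag_mx (expm (t *: L)).
Proof. by move=> dL; rewrite expm_diag// diag_mx_is_diag. Qed.

Lemma char_poly_orthoconj P X : P *m P^T = 1%:M ->
  char_poly (P *m X *m P^T) = char_poly X.
Proof.
move=> PPt; have mP : map_mx polyC P *m map_mx polyC P^T = 1%:M.
  by rewrite -map_mxM PPt map_mx1.
rewrite /char_poly /char_poly_mx.
have -> : 'X%:M - map_mx polyC (P *m X *m P^T) =
    map_mx polyC P *m ('X%:M - map_mx polyC X) *m map_mx polyC P^T.
  rewrite mulmxBr mulmxBl !map_mxM; congr (_ - _).
  by rewrite scalar_mxC -mulmxA mP mulmx1.
by rewrite !det_mulmx mulrAC -det_mulmx mP det1 mul1r.
Qed.

(** The characteristic polynomials agree, and a product of monic linear factors determines its roots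
    up to order. *)
Lemma diag_conj_perm P Q X Y : P *m P^T = 1%:M -> Q *m Q^T = 1%:M ->
  is_diag_mx X -> is_diag_mx Y -> P *m X *m P^T = Q *m Y *m Q^T ->
  exists s, forall i, Y i i = X (s i) (s i).
Proof.
move=> PPt QQt dX dY /(congr1 (fun Z => char_poly Z)).
rewrite !char_poly_orthoconj// !char_poly_trig ?is_diag_mx_is_trig//.
pose tX := [tuple X i i | i < p]; pose tY := [tuple Y i i | i < p].
move=> XY; have /tuple_permP [s sE] : perm_eq tY tX.
  apply: prod_XsubC_eq; rewrite !big_tuple.
  under eq_bigr do rewrite tnth_mktuple.
  by under [RHS]eq_bigr do rewrite tnth_mktuple.
exists s => i.
have : tY = [tuple tnth tX (s i) | i < p] by exact: val_inj.
by move=> /(congr1 (fun u => tnth u i)); rewrite !tnth_mktuple.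
Qed.

Lemma commuting_diag D L X : is_diag_mx D -> is_diag_mx L ->
  blockmx (same_block D L) X -> X *m D = D *m X /\ X *m L = L *m X.
Proof.
move=> dD dL bX; split; apply/matrixP => i j;
  rewrite mulmx_diagr// mulmx_diagl// mulrC;
  have [/andP[/eqP D1 /eqP L1]|/bX->] := boolP (same_block D L i j);
  by rewrite ?mulr0 ?D1 ?L1.
Qed.

Lemma same_block_refl D L : reflexive (same_block D L).
Proof. by move=> i; rewrite /same_block !eqxx. Qed.

Lemma same_block_trans D L : transitive (same_block D L).
Proof.
by move=> j i k /andP[/eqP Dij /eqP Lij] /andP[/eqP Djk /eqP Ljk];
  rewrite /same_block Dij Djk Lij Ljk !eqxx.
Qed.

End Diagonal.

(** * Signed permutation matrices *)

Section SignedPermutation.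
Context {R : realType} {p : nat}.
Hypothesis p_gt0 : (0 < p)%N.
Implicit Types (D X : 'M[R]_p) (s : 'S_p).

Lemma Pmx0E s : Pmx0 s = (perm_mx s)^T :> 'M[R]_p.
Proof. by apply/matrixP => i j; rewrite !mxE eq_sym. Qed.

Definition flip_sign (i : 'I_p) : R := if val i == 0%N then -1 else 1.

Lemma flip1E : flip1 = diag_mx (\row_i flip_sign i) :> 'M[R]_p.
Proof.
by apply/matrixP => i j; rewrite !mxE;
  case: eqP => [->|]; rewrite ?mulr1n ?mulr0n.
Qed.

Lemma det_flip1 : \det (flip1 : 'M[R]_p) = -1.
Proof.
rewrite flip1E det_diag (bigD1 (Ordinal p_gt0))//= !mxE /flip_sign eqxx.
rewrite big1 ?mulr1//.
by move=> i /negbTE i0; rewrite mxE -(inj_eq val_inj) /= in i0 *; rewrite i0.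
Qed.

Lemma flip1_sqr : flip1 *m flip1^T = 1%:M :> 'M[R]_p.
Proof.
rewrite flip1E tr_diag_mx mulmx_diag; apply/matrixP => i j; rewrite !mxE.
by congr (_ *+ _); rewrite /flip_sign; case: ifP; rewrite ?mulrNN mulr1.
Qed.

Lemma Pmx0_ortho s : Pmx0 s *m (Pmx0 s)^T = 1%:M :> 'M[R]_p.
Proof. by rewrite Pmx0E trmxK tr_perm_mx -perm_mxM mulVg perm_mx1. Qed.

(** [\det (Pmx0 s)] is the sign of [s], and [flip1], of determinant -1, corrects it when it is
    negative. *)
Lemma Pmx_SO s : SO p (Pmx s : 'M[R]_p).
Proof.
rewrite /Pmx; case: eqP => [d1|dN1]; split => //; first exact: Pmx0_ortho.
  rewrite trmx_mul mulmxA -(mulmxA _ _ (Pmx0 s)^T) Pmx0_ortho mulmx1.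
  exact: flip1_sqr.
rewrite det_mulmx det_flip1 mulN1r.
move: dN1; rewrite Pmx0E det_tr det_perm.
by case: (odd_perm s); rewrite ?expr1 ?opprK ?expr0.
Qed.

Lemma perm_conj0E s D i j : is_diag_mx D ->
  (Pmx0 s *m D *m (Pmx0 s)^T) i j = D (s^-1 i)%g (s^-1 i)%g *+ (i == j).
Proof.
move=> dD; rewrite mxE (bigD1 (s^-1 i)%g)//= big1 ?addr0 => [|k ki].
  by rewrite mulmx_diagr// !mxE permKV eqxx mul1r eq_sym mulr_natr.
rewrite mulmx_diagr// !mxE; case: eqP => [ik|_]; last by rewrite !mul0r.
by rewrite ik permK eqxx in ki.
Qed.

(** The flip acts on both sides, so its signs cancel on the diagonal. The inverse appears because
    column [j] of [Pmx0 s] has its 1 in row [s j]. *)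
Lemma perm_conjE s D i j : is_diag_mx D ->
  perm_conj s D i j = D (s^-1 i)%g (s^-1 i)%g *+ (i == j).
Proof.
move=> dD; rewrite /perm_conj /Pmx; case: ifP => _; first exact: perm_conj0E.
rewrite trmx_mul !mulmxA -!(mulmxA flip1) flip1E tr_diag_mx.
rewrite mulmx_diagl ?diag_mx_is_diag// mulmx_diagr ?diag_mx_is_diag//.
rewrite perm_conj0E// !mxE !eqxx !mulr1n.
case: eqP => [->|_]; last by rewrite !mulr0n mul0r mulr0.
by rewrite mulr1n mulrCA /flip_sign; case: ifP => _; rewrite ?mulrNN !mulr1.
Qed.

Lemma perm_conj_diag s D : is_diag_mx D -> is_diag_mx (perm_conj s D).
Proof.
move=> dD; apply/is_diag_mxP => i j ij; rewrite perm_conjE//.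
by rewrite -(inj_eq val_inj) (negbTE ij).
Qed.

End SignedPermutation.

(** * Comparison of the two curves through a relative rotation *)

Section ScalingRotation.
Context {R : realType} {p : nat}.
Implicit Types (U V P Q M L D A B X Y : 'M[R]_p) (s : 'S_p) (t : R).

Lemma expm_ortho A t : so p A -> expm (t *: A) *m (expm (t *: A))^T = 1%:M.
Proof. by move=> soA; rewrite expm_tr soA expmMN. Qed.

Lemma so_conj_by U A : so p A -> so p (conj_by U A).
Proof.
move=> soA; rewrite /so /= /conj_by !trmx_mul trmxK soA.
by rewrite mulNmx mulmxN mulmxA.
Qed.

Lemma so_sub A B : so p A -> so p B -> so p (A - B).
Proof.
by rewrite /so /= => sA sB; rewrite linearB /= sA sB opprB addrC opprK.
Qed.

Lemma so_ad A B : so p A -> so p B -> so p (ad A B).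
Proof.
rewrite /so /= /ad => sA sB; rewrite linearB /= !trmx_mul sA sB.
by rewrite !mulNmx !mulmxN !opprK opprB.
Qed.

Lemma orthoM P Q : P *m P^T = 1%:M -> Q *m Q^T = 1%:M ->
  (P *m Q) *m (P *m Q)^T = 1%:M.
Proof. by move=> oP oQ; rewrite trmx_mul mulmxA -(mulmxA P) oQ mulmx1. Qed.

Lemma ortho_conj_inj P X Y : P *m P^T = 1%:M ->
  P *m X *m P^T = P *m Y *m P^T -> X = Y.
Proof.
move=> PPt; have PtP := mulmx1C PPt.
move=> /(congr1 (fun Z => P^T *m Z *m P)).
by rewrite !mulmxA PtP !mul1mx -!(mulmxA _ P^T) PtP !mulmx1.
Qed.

Lemma sr_curveE U D A L t : U *m U^T = 1%:M -> sr_curve U D A L t =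
  (U *m expm (t *: conj_by U A)) *m (D *m expm (t *: L))
    *m (U *m expm (t *: conj_by U A))^T.
Proof.
move=> UUt; rewrite /sr_curve -expm_conj_by// trmx_mul expm_tr.
by rewrite !mulmxA.
Qed.

(** [P^T] in the frame cancels against the conjugation of [D] and [L] by [P], so the permutation is
    invisible after composition. *)
Lemma eig_comp_geodE U Q P D B L t : U *m U^T = 1%:M -> P *m P^T = 1%:M ->
  eig_comp (geod (U *m Q *m P^T) (P *m D *m P^T) B (P *m L *m P^T) t) =
  (U *m expm (t *: conj_by U B) *m Q) *m (expm (t *: L) *m D)
    *m (U *m expm (t *: conj_by U B) *m Q)^T.
Proof.
move=> UUt PPt; have PtP := mulmx1C PPt.
rewrite /eig_comp /geod /= -expm_conj_by// -expm_conj// !trmx_mul trmxK.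
by rewrite !mulmxA -!(mulmxA _ P^T P) PtP !mulmx1.
Qed.

Lemma expm_diag_comm D L t : is_diag_mx D -> is_diag_mx L ->
  D *m expm (t *: L) = expm (t *: L) *m D.
Proof.
move=> dD dL; rewrite expm_diag//; apply/matrixP => i j.
rewrite mulmx_diagl// mulmx_diagr// !mxE mulrC.
by have [->//|_] := eqVneq i j; rewrite !mulr0n !mul0r.
Qed.

(** The right factor that turns [expm (t *: B)] into [expm (t *: A)]. *)
Definition rel_rotation A B t := expm (t *: - B) *m expm (t *: A).

Lemma rel_rotation_ortho A B t : so p A -> so p B ->
  rel_rotation A B t *m (rel_rotation A B t)^T = 1%:M.
Proof.
move=> sA sB; apply: orthoM; last exact: expm_ortho.
by apply: expm_ortho; rewrite /so /= linearN /= sB.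
Qed.

(** Both curves are conjugates by the same orthogonal matrix [U *m EB], which cancels. *)
Lemma sr_curve_eq_geod U Q P D A B L t : U *m U^T = 1%:M -> P *m P^T = 1%:M ->
  is_diag_mx D -> is_diag_mx L -> so p A -> so p B ->
  let F := rel_rotation (conj_by U A) (conj_by U B) t in
  let Phi := expm (t *: L) *m D in
  sr_curve U D A L t =
    eig_comp (geod (U *m Q *m P^T) (P *m D *m P^T) B (P *m L *m P^T) t)
  <-> F *m Phi *m F^T = Q *m Phi *m Q^T.
Proof.
move=> UUt PPt dD dL sA sB F Phi.
rewrite sr_curveE// eig_comp_geodE// (expm_diag_comm t dD dL) -/Phi.
set EA := expm (t *: conj_by U A); set EB := expm (t *: conj_by U B).
have EAE : EA = EB *m F.
  by rewrite /F /rel_rotation mulmxA expmMN mul1mx.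
have oEB : (U *m EB) *m (U *m EB)^T = 1%:M.
  by apply: orthoM => //; apply/expm_ortho/so_conj_by.
have conjE X : (U *m EB *m X) *m Phi *m (U *m EB *m X)^T =
    (U *m EB) *m (X *m Phi *m X^T) *m (U *m EB)^T.
  by rewrite [(U *m EB *m X)^T]trmx_mul !mulmxA.
rewrite EAE mulmxA !conjE; split=> [|->//].
exact: ortho_conj_inj.
Qed.

Lemma ortho_comm Q X : Q *m Q^T = 1%:M -> Q *m X *m Q^T = X <-> Q *m X = X *m Q.
Proof.
move=> oQ; have Qo := mulmx1C oQ; split=> [E|->].
  by rewrite -{2}E -!mulmxA Qo mulmx1.
by rewrite -mulmxA oQ mulmx1.
Qed.

Lemma ortho_conj_expm D L Q t : Q *m Q^T = 1%:M ->
  Q *m D *m Q^T = D -> Q *m L *m Q^T = L ->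
  Q *m (expm (t *: L) *m D) *m Q^T = expm (t *: L) *m D.
Proof.
move=> oQ QD QL; apply/ortho_comm => //; move/ortho_comm: QD => /(_ oQ) QD.
have QE := expm_conj L t oQ; rewrite QL in QE.
by move/ortho_comm: QE => /(_ oQ) QE; rewrite mulmxA QE -!mulmxA QD.
Qed.

(** With [Z = A - B] and [K = Q L Q^T], the derivative at 0 of the hypothesis reads
    [Z D + L D = K D + D Z], from which [K = L] follows entry by entry. *)
Lemma G2_of_conj D L Q A B (a b : R) :
  is_diag_mx D -> (forall i, D i i != 0) -> is_diag_mx L -> SO p Q ->
  so p A -> so p B -> a < b -> 0 \in `[a, b] ->
  Q *m D *m Q^T = D ->
  (forall t, t \in `]a, b[ ->
    rel_rotation A B t *m (expm (t *: L) *m D) *m (rel_rotation A B t)^T =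
    Q *m (expm (t *: L) *m D) *m Q^T) ->
  G2_ D L Q.
Proof.
move=> dD D0 dL soQ sA sB ab ab0 QD FE; have [oQ _] := soQ.
split=> //; split => //.
pose F t := expm (t *: - B) *m 1%:M *m expm (t *: A).
pose F1 t := expm (t *: - B) *m (1%:M *m A - B *m 1%:M) *m expm (t *: A).
have dF : mxderiv F F1 by exact: mxderiv_twist.
have dF1 := @mxderiv_twist R p A B (1%:M *m A - B *m 1%:M).
pose Phi t := expm (t *: L) *m D; pose Phi1 t := expm (t *: L) *m L *m D.
have dPhi : mxderiv Phi Phi1 by exact/mxderivMr/mxderiv_expmr.
have dPhi1 := mxderivMr D (mxderivMr L (mxderiv_expmr L)).
(* The transposed rotation is moved to the other side, so that only [F] itself is differentiated. *)
pose H t := F t *m Phi t - Q *m Phi t *m Q^T *m F t.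
pose H1 t := (F1 t *m Phi t + F t *m Phi1 t) -
  (Q *m Phi1 t *m Q^T *m F t + Q *m Phi t *m Q^T *m F1 t).
have dK : mxderiv (fun t => Q *m Phi t *m Q^T) (fun t => Q *m Phi1 t *m Q^T).
  exact/mxderivMr/mxderivMl.
have dK1 := mxderivMr Q^T (mxderivMl Q dPhi1).
have dH : mxderiv H H1 by apply: mxderivB; exact: mxderivM.
have dH1 := mxderivB (mxderivD (mxderivM dF1 dPhi) (mxderivM dF dPhi1))
  (mxderivD (mxderivM dK1 dF) (mxderivM dK dF1)).
have H0 t : t \in `]a, b[ -> H t = 0.
  move=> tab; have FE1 := FE t tab; have oF := rel_rotation_ortho t sA sB.
  rewrite /H /F mulmx1 -[expm _ *m expm _]/(rel_rotation A B t) -/(Phi t) -FE1.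
  by rewrite -!mulmxA (mulmx1C oF) mulmx1 subrr.
have H10 : H1 0 = 0.
  apply/matrixP => i j; rewrite [RHS]mxE.
  apply: (derive_eq0_itvcc (g := fun t => H1 t i j) ab (dH i j)) => //.
    exact: mxderiv_continuous dH1.
  by move=> t tab; rewrite H0 ?mxE.
move: H10; rewrite /H1 /F1 /F /Phi /Phi1 !expm0 !mul1mx !mulmx1 QD.
set Z := A - B; pose K := Q *m L *m Q^T.
have KDE : K *m D = Q *m (L *m D) *m Q^T.
  by rewrite /K -{1}QD !mulmxA -(mulmxA _ Q^T Q) (mulmx1C oQ) mulmx1.
have DKE : D *m K = Q *m (D *m L) *m Q^T.
  by rewrite /K -{1}QD !mulmxA -(mulmxA _ Q^T Q) (mulmx1C oQ) mulmx1.
have DL : D *m L = L *m D.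
  apply/matrixP => i j; rewrite mulmx_diagl// mulmx_diagr// mulrC.
  have [->//|ij] := eqVneq i j.
  by rewrite (is_diag_mxP dL i j ij) !mul0r.
move=> /eqP; rewrite subr_eq0 -KDE => /eqP HE.
apply/matrixP => i j; rewrite -/K.
have KD : K i j * D j j = D i i * K i j.
  by rewrite -mulmx_diagr// -mulmx_diagl// KDE DKE DL.
have {HE} : Z i j * D j j + L i j * D j j = K i j * D j j + D i i * Z i j.
  have := congr1 (fun X : 'M[R]_p => X i j) HE.
  rewrite [LHS]mxE [RHS]mxE (mulmx_diagl Z i j dD) (mulmx_diagr Z i j dD).
  by rewrite (mulmx_diagr L i j dD) (mulmx_diagr K i j dD).
(* For equal values the [Z] terms cancel and [D j j] is divided out; otherwise both entries vanish,
   since [L] is diagonal and [K] commutes with [D]. *)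
have [Dij|Dij] := eqVneq (D i i) (D j j).
  rewrite Dij [D j j * _]mulrC addrC => /addIr /(mulIf (D0 j)) //.
move=> _; rewrite (is_diag_mxP dL i j); last first.
  by apply: contra_neq Dij => /val_inj ->.
apply/eqP; move/eqP: KD; rewrite mulrC -subr_eq0 -mulrBl mulf_eq0 subr_eq0.
by rewrite eq_sym (negbTE Dij).
Qed.

End ScalingRotation.

(** * Segments from 0 inside an interval, on either side *)

Section Intervals.
Context {R : realType}.

Lemma mem_minmax0 (c t : R) :
  t \in `]Num.min 0 c, Num.max 0 c[ -> exists u, [/\ 0 < u, u < 1 & t = u * c].
Proof.
rewrite in_itv /= => /andP[].
have [c0|c0|<-] := ltgtP c 0; last by move=> t0 /(lt_trans t0); rewrite ltxx.
- move=> ct t0; exists (t / c); have cN : c != 0 by rewrite lt_eqF.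
  by rewrite divfK// ltr_ndivrMr// ltr_ndivlMr// mul0r mul1r.
- move=> t0 tc; exists (t / c); have cN : c != 0 by rewrite gt_eqF.
  by rewrite divfK// ltr_pdivrMr// ltr_pdivlMr// mul0r mul1r.
Qed.

Lemma is_interval_scale (I : set R) c u : is_interval I -> I 0 -> I c ->
  0 <= u -> u <= 1 -> I (u * c).
Proof.
move=> iI I0 Ic u0 u1; have [c0|c0] := leP 0 c.
  by apply: (iI 0 c) => //; rewrite mulr_ge0//= ler_piMl.
by apply: (iI c 0) => //; apply/andP; split; nra.
Qed.

End Intervals.

(** Pigeonhole on the first [#|T|.+1] integers. *)
Lemma nat_finType_collision (T : finType) (f : nat -> T) :
  exists n m : nat, n != m /\ f n = f m.
Proof.
have : ~~ injectiveb (fun i : 'I_#|T|.+1 => f i).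
  by apply/injectiveP => /leq_card; rewrite card_ord ltnn.
by move=> /injectivePn [i [j ij fij]]; exists (val i), (val j).
Qed.

(** * Matching and separating eigenvalues along the curves *)

Section Curves.
Context {R : realType} {p : nat}.
Implicit Types (U V Q M L D E A B : 'M[R]_p) (s : 'S_p).

(** The permutation may depend on time, but two of infinitely many times share one, and two times
    determine the affine logarithms. *)
Lemma affine_family_perm (T : set R) D L E M :
  is_interval T -> T 0 -> (exists2 c, c != 0 & T c) ->
  (forall i, 0 < D i i) -> (forall i, 0 < E i i) ->
  (forall t, T t -> exists s, forall i,
    expR (t * M i i) * E i i = expR (t * L (s i) (s i)) * D (s i) (s i)) ->
  exists s, forall i, E i i = D (s i) (s i) /\ M i i = L (s i) (s i).
Proof.
move=> iT T0 [c c0 Tc] D0 E0 sT.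
(* The sample times [c / (n + 1)] are pairwise distinct because [c != 0]. *)
have Tn n : T (n.+1%:R^-1 * c).
  by apply: is_interval_scale => //; rewrite invf_le1// ler1n.
have /choice[f fE] n := sT _ (Tn n).
have [n [m [nm fnm]]] := nat_finType_collision f.
exists (f n) => i.
apply: (@expR_affine_inj R _ _ _ _ (n.+1%:R^-1 * c) (m.+1%:R^-1 * c)) => //.
  apply: contra nm => /eqP /(mulIf c0) /invr_inj /eqP.
  by rewrite eqr_nat eqSS.
by rewrite fnm.
Qed.

Lemma curve_spectrum_perm (T : set R) U D A L V E B M :
  is_interval T -> T 0 -> (exists2 c, c != 0 & T c) ->
  SO p U -> Diag_pos p D -> so p A -> Diag p L ->
  SO p V -> Diag_pos p E -> so p B -> Diag p M ->
  (forall t, T t -> sr_curve U D A L t = eig_comp (geod V E B M t)) ->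
  exists s, E = perm_conj s D /\ M = perm_conj s L.
Proof.
move=> iT T0 Tc [oU _] [dD D0] sA dL [oV _] [dE E0] sB dM h.
have [|s sE] := affine_family_perm (L := L) (M := M) iT T0 Tc D0 E0.
  move=> t Tt; have := h t Tt; rewrite sr_curveE// (expm_diag_comm t dD dL).
  rewrite /eig_comp /geod /= => /diag_conj_perm [].
  - by apply: orthoM => //; exact/expm_ortho/so_conj_by.
  - by apply: orthoM => //; exact/expm_ortho.
  - by rewrite is_diag_mulmx ?expm_is_diag.
  - by rewrite is_diag_mulmx ?expm_is_diag.
  move=> s sE; exists s => i; move: (sE i).
  by rewrite !mulmx_diagr// !expm_diag// !mxE !eqxx !mulr1n.
(* The inverse compensates for the one in [perm_conjE]. *)
exists (s^-1)%g; split; apply: diag_mx_ext => //; try exact: perm_conj_diag;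
  by move=> i; rewrite perm_conjE// eqxx mulr1n invgK; case: (sE i).
Qed.

(** Eigenvalues from different blocks coincide at most once, so some segment starting at 0 avoids
    that time in its interior. *)
Lemma distinct_near0 (T : set R) D L (i j : 'I_p) :
  is_interval T -> T 0 -> (exists2 c, c != 0 & T c) ->
  (forall k, 0 < D k k) -> ~~ same_block D L i j ->
  exists a b, [/\ a < b, 0 \in `[a, b] & forall t, t \in `]a, b[ ->
    T t /\ expR (t * L i i) * D i i != expR (t * L j j) * D j j].
Proof.
move=> iT T0 [c c0 Tc] D0 ij.
pose eqt t := expR (t * L i i) * D i i = expR (t * L j j) * D j j.
have uniq_t (s t : R) : eqt s -> eqt t -> s = t.
  move=> es et; apply/eqP; apply: contraNT ij => st.
  have [] := expR_affine_inj (D0 i) (D0 j) st es et.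
  by rewrite /same_block => -> ->; rewrite !eqxx.
have [c' [c'0 Tc' c'N]] : exists c', [/\ c' != 0, T c' &
    forall u, 0 < u -> u < 1 -> ~ eqt (u * c')].
  have [[u [u0 u1 eu]]|nu] :=
      pselect (exists u, [/\ 0 < u, u < 1 & eqt (u * c)]).
    (* A meeting time inside the segment becomes its new end, which the open interval excludes. *)
    exists (u * c); split; first by rewrite mulf_neq0// gt_eqF.
      by apply: is_interval_scale => //; exact: ltW.
    move=> v v0 v1 /uniq_t /(_ eu); rewrite -[RHS]mul1r.
    have uc0 : u * c != 0 by rewrite mulf_neq0// gt_eqF.
    by move=> /(mulIf uc0) v1E; rewrite v1E ltxx in v1.
  by exists c; split=> // u u0 u1 eu; apply: nu; exists u.
exists (Num.min 0 c'), (Num.max 0 c'); split.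
- by rewrite gt_min !lt_max ltxx /= ltxx orbF orbC -neq_lt.
- by rewrite in_itv /= ge_min le_max lexx.
- move=> t /mem_minmax0 [u [u0 u1 ->]]; split.
    by apply: is_interval_scale => //; exact: ltW.
  by apply/eqP; exact: c'N.
Qed.

End Curves.

(** * Geodesics lying over a scaling-rotation curve *)

Theorem theorem3p8 (R : realType) (p : nat) (hp : (0 < p)%N)
    (U D A L : 'M[R]_p)
    (hU : SO p U) (hD : Diag_pos p D) (hA : so p A) (hL : Diag p L)
    (I : set R) (hI : is_interval I) (hI0 : I 0)
    (hIlen : exists a b : R, [/\ I a, I b & a < b])
    (gamma : R -> 'M[R]_p * 'M[R]_p) (hgamma : geodesic_on I gamma) :
  (forall t : R, I t -> sr_curve U D A L t = eig_comp (gamma t))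
  <->
  exists (s : 'S_p) (Q B : 'M[R]_p),
    [/\ G2_ D L Q,
        so p B,
        g2_ D L (conj_by U B - conj_by U A),
        (forall j : nat, (1 <= j)%N ->
           g2_ D L (iter j (ad (conj_by U B)) (conj_by U A)))
      & forall t : R, I t ->
          gamma t
          = geod (U *m Q *m (Pmx s)^T) (perm_conj s D) B (perm_conj s L) t].
Proof.
have [dD D0] := hD; have [oU dU] := hU.
have sA := so_conj_by U hA.
have Ic : exists2 c, c != 0 & I c.
  have [a [b [Ia Ib ab]]] := hIlen.
  have [a0|a0] := eqVneq a 0; last by exists a.
  by exists b => //; rewrite gt_eqF// -a0.
split=> [h|[s [Q [B [GQ sB [_ BA] ad_g gE]]]] t It].
  have [V [E [B [M [hV hE sB dM gE]]]]] := hgamma.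
  have {}h t : I t -> sr_curve U D A L t = eig_comp (geod V E B M t).
    by move=> It; rewrite h// gE.
  have [s [EE ME]] :=
    curve_spectrum_perm hI hI0 Ic hU hD hA hL hV hE sB dM h.
  have [oP dP] := Pmx_SO (R := R) hp s; have Po := mulmx1C oP.
  have [oV dV] := hV.
  (* The only choice compatible with [V = U *m Q *m (Pmx s)^T]. *)
  pose Q := U^T *m V *m Pmx s; exists s, Q, B.
  have VE : V = U *m Q *m (Pmx s)^T.
    by rewrite /Q !mulmxA oU mul1mx -mulmxA oP mulmx1.
  have sB' := so_conj_by U sB.
  have hQ : SO p Q.
    split; last by rewrite /Q !det_mulmx det_tr dU dV dP !mulr1.
    apply: orthoM; last by rewrite oP.
    by apply: orthoM => //; rewrite trmxK (mulmx1C oU).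
  have {}h t : I t -> rel_rotation (conj_by U A) (conj_by U B) t
      *m (expm (t *: L) *m D)
      *m (rel_rotation (conj_by U A) (conj_by U B) t)^T =
      Q *m (expm (t *: L) *m D) *m Q^T.
    move=> It; apply/(@sr_curve_eq_geod _ _ U Q (Pmx s)) => //.
    by rewrite h// VE EE ME.
  (* At time 0 the relative rotation is the identity. *)
  have QD : Q *m D *m Q^T = D.
    have := h 0 hI0; rewrite /rel_rotation !expm0 !mul1mx trmx1 mulmx1.
    by move=> <-.
  have GQ : G2_ D L Q.
    have [c c0 Tc] := Ic.
    apply: (@G2_of_conj _ _ D L Q _ _ (Num.min 0 c) (Num.max 0 c)
      _ _ _ _ sA sB') => //.
    - by move=> i; rewrite gt_eqF.
    - by rewrite gt_min !lt_max ltxx /= ltxx orbF orbC -neq_lt.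
    - by rewrite in_itv /= ge_min le_max lexx.
    - move=> t /mem_minmax0 [u [u0 u1 ->]]; apply: h.
      by apply: is_interval_scale => //; exact: ltW.
  (* Each pair [i], [j] from different blocks gets its own interval: there the rotation commutes
     with a diagonal matrix whose entries [i] and [j] differ, so its entry [(i, j)] vanishes. *)
  have bX k : blockmx (same_block D L) (twist (conj_by U A) (conj_by U B) k).
    have [[[oQ _] _] [_ QL]] := GQ; move=> i j ij.
    have [a [b [ab ab0 abN]]] := distinct_near0 hI hI0 Ic D0 ij.
    apply: (twist_eq0 ab ab0) => t /abN [It /eqP phi_ij].
    have := h t It; rewrite (ortho_conj_expm t oQ QD QL).
    move=> /(ortho_comm _ (rel_rotation_ortho t sA sB')) FPhi.
    have dPhi : is_diag_mx (expm (t *: L) *m D).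
      by rewrite is_diag_mulmx ?expm_is_diag.
    have := congr1 (fun X : 'M[R]_p => X i j) FPhi.
    rewrite (mulmx_diagr _ _ _ dPhi) (mulmx_diagl _ _ _ dPhi).
    rewrite !(mulmx_diagr (expm _) _ _ dD) (expm_diag t hL).
    rewrite !mxE !eqxx !mulr1n => /eqP.
    rewrite mulrC -subr_eq0 -mulrBl mulf_eq0 subr_eq0.
    by move=> /orP[/eqP/esym/phi_ij|/eqP].
  have [bBA bad] := (blockmx_ad_twist (@same_block_refl _ _ D L)
    (@same_block_trans _ _ D L) _ _).2 bX.
  split=> //.
  - by split=> //; exact: so_sub.
  - move=> j j1; split; last exact: bad.
    by case: j {j1} => // j; elim: j => [|j IHj] /=; exact: so_ad.
  - by move=> t It; rewrite gE// VE EE ME.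
have [oP dP] := Pmx_SO (R := R) hp s.
have sB' := so_conj_by U sB.
have bX : forall k,
    blockmx (same_block D L) (twist (conj_by U A) (conj_by U B) k).
  apply/(blockmx_ad_twist (@same_block_refl _ _ D L)
    (@same_block_trans _ _ D L)).
  by split=> // j /ad_g [].
rewrite gE//; apply/sr_curve_eq_geod => //.
have [[[oQ _] QD] [_ QL]] := GQ; rewrite (ortho_conj_expm t oQ QD QL).
have oF := rel_rotation_ortho t sA sB'.
(* The relative rotation is block diagonal at every time, hence commutes with [D] and [L] and fixes
   the same diagonal curve as [Q]. *)
have bF : blockmx (same_block D L)
    (rel_rotation (conj_by U A) (conj_by U B) t).
  by move=> i j ij; apply: expm_twist_eq0 => k; exact: bX.
have [FD FL] := commuting_diag dD hL bF.
by apply: ortho_conj_expm => //; apply/(ortho_comm _ oF).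
Qed.
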